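(* Let $\gamma$ be a $\mathcal{C}_+^2$ closed and strictly convex curve in the Euclidean plane $\mathbb{R}^2$ with length $L$ and enclosing a region of area $A$. Let $\rho(\theta)$ be the radius of curvature of $\gamma$ and let $\tilde A$ be the (oriented) area of the domain enclosed by the locus of curvature centers of $\gamma$. Then for arbitrary real constants $\alpha,\beta,\lambda,\delta$ satisfying $$2\alpha+\delta\ge 0,\qquad 2\alpha+4\pi\beta+\lambda\ge 0,\qquad 6\alpha-\lambda+4\delta\ge 0,$$ we have $$\alpha\int_0^{2\pi}\rho(\theta)^2\,d\theta+\beta L^2+\lambda A+\delta|\tilde A|\ge 0.$$ Equality holds in this inequality if $\gamma$ is a circle and the parameters satisfy $2\alpha+4\pi\beta+\lambda=0$. Moreover, if equality holds in this inequality and the parameters satisfy $$2\alpha+\delta>0,\qquad 2\alpha+4\pi\beta+\lambda=0,\qquad 6\alpha-\lambda+4\delta=0,$$ then the Minkowski support function of $\gamma$ is of the form $$p(\theta)=a_0+a_1\cos\theta+b_1\sin\theta+a_2\cos 2\theta+b_2\sin 2\theta$$ for some real constants $a_0,a_1,b_1,a_2,b_2$.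
   Context: A $\mathcal{C}_+^2$ closed and strictly convex plane curve is a closed convex curve of class $C^2$ with everywhere positive curvature. It is parametrized by the angle $\theta\in[0,2\pi]$ between the $x$-axis and the outward unit normal vector at the corresponding point. Its Minkowski support function $p(\theta)$ is the $2\pi$-periodic function such that $$\gamma(\theta)=\big(p(\theta)\cos\theta-p'(\theta)\sin\theta,\ p(\theta)\sin\theta+p'(\theta)\cos\theta\big).$$ The radius of curvature is $\rho(\theta)=p(\theta)+p''(\theta)>0$. The length is $L=\int_0^{2\pi}p(\theta)\,d\theta$ and the enclosed area is $A=\frac12\int_0^{2\pi}\big(p(\theta)^2-p'(\theta)^2\big)\,d\theta$. The locus of curvature centers is the curve $$\theta\mapsto\big(-p'(\theta)\sin\theta-p''(\theta)\cos\theta,\ p'(\theta)\cos\theta-p''(\theta)\sin\theta\big),$$ and $\tilde A$ denotes the oriented area of the domain it encloses, given by $\tilde A=\frac12\int_0^{2\pi}\big(p'(\theta)^2-p''(\theta)^2\big)\,d\theta$. *)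

(* Defs.v *)
From Stdlib Require Import Reals.
From Coquelicot Require Import Coquelicot.
Open Scope R_scope.

Definition class_C2 (f : R -> R) : Prop :=
  forall t, ex_derive f t /\ ex_derive (Derive f) t /\
            continuous (Derive_n f 2) t.

Definition xcoord (c : R -> R * R) (t : R) : R := fst (c t).
Definition ycoord (c : R -> R * R) (t : R) : R := snd (c t).

Definition speed (c : R -> R * R) (t : R) : R :=
  sqrt (Derive (xcoord c) t ^ 2 + Derive (ycoord c) t ^ 2).

(* Signed curvature, positive when the curve turns counterclockwise. *)
Definition curvature (c : R -> R * R) (t : R) : R :=
  (Derive (xcoord c) t * Derive_n (ycoord c) 2 t
   - Derive (ycoord c) t * Derive_n (xcoord c) 2 t) / speed c t ^ 3.

(* Signed (up to the factor [speed c t]) distance of the point [q] to the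
   tangent line of [c] at [c t]. *)
Definition tangent_side (c : R -> R * R) (t : R) (q : R * R) : R :=
  Derive (xcoord c) t * (snd q - ycoord c t)
  - Derive (ycoord c) t * (fst q - xcoord c t).

(* A closed convex curve is a simple closed regular curve lying on one side of
   each of its tangent lines.  Since the curvature is signed, its positivity
   also fixes the counterclockwise orientation. *)
Record C2_plus_closed_convex (c : R -> R * R) (T : R) : Prop := {
  C2p_period_pos : 0 < T;
  C2p_closed : forall t, c (t + T) = c t;
  C2p_simple : forall s t, 0 <= s < T -> 0 <= t < T -> c s = c t -> s = t;
  C2p_class_x : class_C2 (xcoord c);
  C2p_class_y : class_C2 (ycoord c);
  C2p_regular : forall t, 0 < speed c t;
  C2p_convex : forall t,
    (forall s, 0 <= tangent_side c t (c s)) \/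
    (forall s, tangent_side c t (c s) <= 0);
  C2p_curvature : forall t, 0 < curvature c t
}.

(* For a counterclockwise convex curve the outward unit normal is the unit
   tangent rotated by -PI/2. *)
Definition outward_normal (c : R -> R * R) (t : R) : R * R :=
  (Derive (ycoord c) t / speed c t, - Derive (xcoord c) t / speed c t).

(* [gamma theta] is the point of [c] whose outward unit normal makes the angle
   [theta] with the x-axis, and [rho theta] is the radius of curvature there. *)
Definition normal_angle_param
    (c gamma : R -> R * R) (rho : R -> R) : Prop :=
  forall theta, exists t,
    outward_normal c t = (cos theta, sin theta) /\
    gamma theta = c t /\ rho theta = / curvature c t.

Record is_support_function (gamma : R -> R * R) (p : R -> R) : Prop := {
  supp_periodic : forall theta, p (theta + 2 * PI) = p theta;
  supp_derivable : forall theta, ex_derive p theta;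
  supp_curve : forall theta,
    gamma theta = (p theta * cos theta - Derive p theta * sin theta,
                   p theta * sin theta + Derive p theta * cos theta)
}.

Definition curve_length (p : R -> R) : R := RInt p 0 (2 * PI).

Definition enclosed_area (p : R -> R) : R :=
  / 2 * RInt (fun theta => p theta ^ 2 - Derive p theta ^ 2) 0 (2 * PI).

(* Oriented area of the locus of curvature centers
   (- p' sin - p'' cos, p' cos - p'' sin).  It is [1/2 \oint x dy - y dx] along
   this locus after an integration by parts, and in this form it makes sense
   when [p] is only of class C^2. *)
Definition curvature_centers_area (p : R -> R) : R :=
  / 2 * RInt (fun theta => Derive p theta ^ 2 - Derive_n p 2 theta ^ 2)
             0 (2 * PI).

Definition is_circle (c : R -> R * R) : Prop :=
  exists (a b r : R), 0 < r /\
    forall q : R * R, (exists t, c t = q) <->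
      (fst q - a) ^ 2 + (snd q - b) ^ 2 = r ^ 2.

(* Main.v *)
Require Import Defs.
From Stdlib Require Import Reals Lra Lia ZArith.
From Coquelicot Require Import Coquelicot.
Open Scope R_scope.

(** Write m for the mean of p.  Integrations by parts give
    E = (2 alpha + 4 PI beta + lambda) L^2 / (4 PI)
      + (6 alpha - lambda + 4 delta) I / 2 + (2 alpha + delta) Q / 2,
    where I = int p'^2 - (p - m)^2 and Q = int p''^2 - 5 p'^2 + 4 (p - m)^2.
    On the n-th Fourier mode the integrands weigh n^2 - 1 and
    (n^2 - 1) (n^2 - 4), but Fourier series are avoided: I >= 0 is Wirtinger's
    inequality, and Q is split along p = e + o with e PI-periodic and o
    PI-antiperiodic.  Since (n^2 - 1) (n^2 - 4) = (n^2 - 4)^2 + 3 (n^2 - 4),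
    Wirtinger's inequality on [0, PI] gives Q(e) >= int (e'' + 4 (e - m))^2.
    Subtracting from o a first harmonic, which Q does not see, makes it vanish to
    first order at 0 and PI, and the same bound applies.  If Q = 0, both parts
    solve f'' + 4 (f - mean f) = 0 on [0, PI].

    That p is of class C^2 with p + p'' = rho comes from p being an upper
    envelope: <c t, (cos th, sin th)> <= p th for all t, with equality when
    th is the normal angle at t, so that the two sides have the same derivative
    in th; composing p' with the normal angle, a C^1 function of t with positive
    derivative, then yields p''. *)

(** * Continuity, differentiation and integration of real functions *)

Lemma continuous_pow2 (f : R -> R) (x : R) :
  continuous f x -> continuous (fun y => f y ^ 2) x.
Proof.
  intros Hf.
  apply continuous_ext with (fun y => mult (f y) (f y)).
  - intros y; unfold mult; simpl; ring.
  - apply (continuous_mult f f x Hf Hf).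
Qed.

Lemma is_derive_continuous (f f' : R -> R) (x : R) :
  (forall y, is_derive f y (f' y)) -> continuous f x.
Proof. intros Hf; apply (ex_derive_continuous f x); eexists; apply Hf. Qed.

Lemma continuous_shift (f : R -> R) (s x : R) :
  (forall y, continuous f y) -> continuous (fun y => f (y + s)) x.
Proof.
  intros Hf.
  apply (continuous_comp (fun y => y + s) f x); [|apply Hf].
  apply (continuous_plus (fun y : R => y) (fun _ => s) x);
    [apply continuous_id|apply continuous_const].
Qed.

Ltac cont :=
  repeat
    match goal with
    | H : continuous ?f ?x |- continuous ?f ?x => exact H
    | H : forall y, continuous ?f y |- continuous ?f _ => apply H
    | H : forall y, is_derive ?f y _ |- continuous ?f _ =>
        exact (is_derive_continuous f _ _ H)
    | H : forall y, continuous ?f y |- continuous (fun x => ?f x) _ => apply H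
    | H : forall y, is_derive ?f y _ |- continuous (fun x => ?f x) _ =>
        exact (is_derive_continuous f _ _ H)
    | |- continuous (fun _ => ?c) _ => apply continuous_const
    | |- continuous (fun y => y) _ => apply continuous_id
    | |- continuous (fun y => cos y) _ => apply continuous_cos
    | |- continuous (fun y => sin y) _ => apply continuous_sin
    | |- continuous cos _ => apply continuous_cos
    | |- continuous sin _ => apply continuous_sin
    | |- continuous (fun y => @?f y ^ 2) ?x => apply (continuous_pow2 f x)
    | |- continuous (fun y => @?f y + @?g y) ?x => apply (continuous_plus f g x)
    | |- continuous (fun y => @?f y - @?g y) ?x => apply (continuous_minus f g x)
    | |- continuous (fun y => @?f y * @?g y) ?x => apply (continuous_mult f g x)
    | |- continuous (fun y => @?f y / ?c) ?x => apply (continuous_mult f (fun _ => / c) x)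
    | |- continuous (fun y => - @?f y) ?x => apply (continuous_opp f x)
    | |- continuous (fun y => ?f (y + ?s)) ?x => apply (continuous_shift f s x); intros
    end.

(** [auto_derive] leaves goals about eta-expanded functions; the test [constr_eq] selects the
    hypothesis about exactly that function, not one that merely unifies with it. *)
Ltac deriv_side :=
  repeat
    match goal with
    | |- _ /\ _ => split
    | |- True => exact I
    | H : forall y, is_derive ?f y _ |- ex_derive ?F ?z =>
        constr_eq F (fun x : R => f x); exact (ex_intro _ _ (H z))
    end.

Ltac deriv_values :=
  repeat
    match goal with
    | H : forall y, is_derive ?f y _ |- context [Derive ?F ?z] =>
        constr_eq F (fun x : R => f x);
        rewrite (is_derive_unique F z _ (H z))
    end.

Ltac derive_from_hyps := auto_derive; [deriv_side | deriv_values].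

Lemma ex_RInt_cont (f : R -> R) (a b : R) :
  (forall x, continuous f x) -> ex_RInt f a b.
Proof. intros Hf; apply (ex_RInt_continuous f a b); intros; apply Hf. Qed.

Lemma RInt_lin3 (f g h : R -> R) (u v w a b : R) :
  (forall x, continuous f x) -> (forall x, continuous g x) -> (forall x, continuous h x) ->
  RInt (fun x => u * f x + v * g x + w * h x) a b =
  u * RInt f a b + v * RInt g a b + w * RInt h a b.
Proof.
  intros Hf Hg Hh.
  apply is_RInt_unique.
  apply (is_RInt_plus (fun x => u * f x + v * g x) (fun x => w * h x)).
  - apply (is_RInt_plus (fun x => u * f x) (fun x => v * g x));
      apply (is_RInt_scal (V := R_NormedModule)), (@RInt_correct R_CompleteNormedModule);
      now apply ex_RInt_cont.
  - apply (is_RInt_scal (V := R_NormedModule)), (@RInt_correct R_CompleteNormedModule).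
    now apply ex_RInt_cont.
Qed.

Lemma RInt_lin3_eq (F f g h : R -> R) (u v w a b : R) :
  (forall x, F x = u * f x + v * g x + w * h x) ->
  (forall x, continuous f x) -> (forall x, continuous g x) -> (forall x, continuous h x) ->
  RInt F a b = u * RInt f a b + v * RInt g a b + w * RInt h a b.
Proof.
  intros E Hf Hg Hh; rewrite <- RInt_lin3 by assumption.
  apply RInt_ext; intros; apply E.
Qed.

Lemma RInt_const_R (k a b : R) : RInt (fun _ => k) a b = (b - a) * k.
Proof. exact (RInt_const (V := R_CompleteNormedModule) a b k). Qed.

Lemma RInt_Chasles_cont (f : R -> R) (a b c : R) :
  (forall x, continuous f x) -> RInt f a c = RInt f a b + RInt f b c.
Proof.
  intros Hf; symmetry.
  apply (RInt_Chasles (V := R_CompleteNormedModule) f a b c); now apply ex_RInt_cont.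
Qed.

Lemma RInt_primitive (F f : R -> R) (a b : R) :
  (forall x, is_derive F x (f x)) -> (forall x, continuous f x) ->
  RInt f a b = F b - F a.
Proof.
  intros HF Hf; apply is_RInt_unique.
  apply (is_RInt_derive F f a b); intros; auto.
Qed.

Lemma RInt_nonneg (f : R -> R) (a b : R) :
  a <= b -> (forall x, continuous f x) -> (forall x, 0 <= f x) -> 0 <= RInt f a b.
Proof.
  intros Hab Hf H0.
  apply RInt_ge_0; [assumption|now apply ex_RInt_cont|auto].
Qed.

(** * Wirtinger's inequality *)

(* The integrand minus the derivative of [k cot (k x + phi) w^2] is the square
   [(w' - k cot (k x + phi) w)^2]. *)
Lemma riccati_bound (w w' : R -> R) (k phi u v : R) :
  u <= v ->
  (forall x, is_derive w x (w' x)) -> (forall x, continuous w' x) ->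
  (forall x, u <= x <= v -> 0 < sin (k * x + phi)) ->
  k * (cos (k * v + phi) / sin (k * v + phi)) * w v ^ 2
  - k * (cos (k * u + phi) / sin (k * u + phi)) * w u ^ 2
  <= RInt (fun x => w' x ^ 2 - k ^ 2 * w x ^ 2) u v.
Proof.
  intros Huv Hw Hw' Hsin.
  set (G := fun x => k * (cos (k * x + phi) / sin (k * x + phi)) * w x ^ 2).
  set (g := fun x => w' x ^ 2 - k ^ 2 * w x ^ 2
              - (w' x - k * (cos (k * x + phi) / sin (k * x + phi)) * w x) ^ 2).
  assert (Hcot : forall x, u <= x <= v ->
    ex_derive (fun x => cos (k * x + phi) / sin (k * x + phi)) x).
  { intros x Hx; specialize (Hsin x Hx); auto_derive; lra. }
  assert (HI : is_RInt g u v (G v - G u)).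
  { apply (is_RInt_derive G g u v); intros x Hx;
      rewrite Rmin_left, Rmax_right in Hx by assumption.
    - specialize (Hsin x Hx); unfold G, g.
      auto_derive.
      + deriv_side; lra.
      + deriv_values.
        assert (E : cos (k * x + phi) ^ 2 = 1 - sin (k * x + phi) ^ 2)
          by (generalize (sin2_cos2 (k * x + phi)); unfold Rsqr; lra).
        set (s := sin (k * x + phi)) in *; set (co := cos (k * x + phi)) in *.
        field_simplify_eq; [|lra].
        rewrite E; ring.
    - pose proof (ex_derive_continuous _ _ (Hcot x Hx)) as Hc.
      unfold g; cont. }
  change (G v - G u <= RInt (fun x => w' x ^ 2 - k ^ 2 * w x ^ 2) u v).
  rewrite <- (is_RInt_unique _ _ _ _ HI).
  apply RInt_le; [assumption|eexists; exact HI| |].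
  - apply ex_RInt_cont; intros x; cont.
  - intros x _; unfold g.
    generalize (pow2_ge_0 (w' x - k * (cos (k * x + phi) / sin (k * x + phi)) * w x)); lra.
Qed.

(** The difference [h x - h (x + l)] takes opposite values at [a] and [a + l], so it vanishes in
    between. *)
Lemma half_period_coincidence (h : R -> R) (a l : R) :
  0 < l -> (forall x, continuous h x) -> h a = h (a + 2 * l) ->
  exists x0, a <= x0 <= a + l /\ h x0 = h (x0 + l).
Proof.
  intros Hl Hh E.
  destruct (IVT_gen (fun x => h x - h (x + l)) a (a + l) 0) as [x0 [Hx0 H0]].
  - intros x; apply continuity_pt_filterlim; change (continuous (fun x => h x - h (x + l)) x); cont.
  - replace (a + l + l) with (a + 2 * l) by ring; rewrite <- E.
    unfold Rmin, Rmax; repeat destruct (Rle_dec _ _); lra.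
  - rewrite Rmin_left, Rmax_right in Hx0 by lra.
    exists x0; split; lra.
Qed.

(* Subtracting the common value of [h] at two points at distance [l] makes both
   of them zeros; on each piece the Riccati comparison then applies with any
   [k < PI / l], for which the cotangent stays finite. *)
Lemma wirtinger_subcritical (h h' : R -> R) (a l e : R) :
  0 < l -> 0 < e < 1 ->
  (forall x, is_derive h x (h' x)) -> (forall x, continuous h' x) ->
  h a = h (a + 2 * l) -> RInt h a (a + 2 * l) = 0 :> R ->
  (PI / l * (1 - e)) ^ 2 * RInt (fun x => h x ^ 2) a (a + 2 * l)
  <= RInt (fun x => h' x ^ 2) a (a + 2 * l).
Proof.
  intros Hl He Hh Hh' Ep Em.
  assert (Hch : forall x, continuous h x) by (intros; cont).
  destruct (half_period_coincidence h a l Hl Hch Ep) as [x0 [Hx0 Ex0]].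
  set (k := PI / l * (1 - e)).
  set (w := fun x => h x - h x0).
  assert (Hw : forall x, is_derive w x (h' x)).
  { intros x; unfold w; derive_from_hyps; ring. }
  pose proof PI_RGT_0 as HPI.
  assert (Hk : 0 < k).
  { unfold k; apply Rmult_lt_0_compat; [apply Rdiv_lt_0_compat|]; lra. }
  assert (Hkl : k * l = PI * (1 - e)) by (unfold k; field; lra).
  (* The phase centres the argument: as [x] runs over [[d, d + l]] it goes from [PI * e / 2] to
     [PI - PI * e / 2], inside the positive arch of the sine. *)
  assert (Hs : forall d x, 0 <= x - d <= l -> 0 < sin (k * x + (PI * e / 2 - k * d))).
  { intros d x Hx.
    replace (k * x + (PI * e / 2 - k * d)) with (k * (x - d) + PI * e / 2) by ring.
    apply sin_gt_0.
    - assert (0 <= k * (x - d)) by (apply Rmult_le_pos; lra); nra.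
    - assert (k * (x - d) <= k * l) by (apply Rmult_le_compat_l; lra); nra. }
  pose proof (riccati_bound w h' k (PI * e / 2 - k * (x0 - l)) a x0 ltac:(lra) Hw Hh'
                ltac:(intros; apply Hs; lra)) as B1.
  pose proof (riccati_bound w h' k (PI * e / 2 - k * x0) x0 (x0 + l) ltac:(lra) Hw Hh'
                ltac:(intros; apply Hs; lra)) as B2.
  pose proof (riccati_bound w h' k (PI * e / 2 - k * (x0 + l)) (x0 + l) (a + 2 * l)
                ltac:(lra) Hw Hh' ltac:(intros; apply Hs; lra)) as B3.
  assert (Hwc : forall x, continuous w x) by (intros; cont).
  assert (Z0 : w x0 = 0) by (unfold w; ring).
  assert (Z1 : w (x0 + l) = 0) by (unfold w; rewrite <- Ex0; ring).
  assert (Zp : w (a + 2 * l) = w a) by (unfold w; rewrite <- Ep; ring).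
  rewrite Z0 in B1, B2; rewrite Z1 in B2, B3; rewrite Zp in B3.
  (* The phases of the first and last pieces agree at [a] and [a + 2 * l], so these boundary terms
     cancel; those at [x0] and [x0 + l] vanish with [w]. *)
  replace (k * (a + 2 * l) + (PI * e / 2 - k * (x0 + l)))
    with (k * a + (PI * e / 2 - k * (x0 - l))) in B3 by ring.
  set (q := fun x => h' x ^ 2 - k ^ 2 * w x ^ 2) in *.
  assert (Hq : forall x, continuous q x) by (intros x; unfold q; cont).
  assert (B : 0 <= RInt q a (a + 2 * l)).
  { rewrite (RInt_Chasles_cont q a x0 (a + 2 * l)), (RInt_Chasles_cont q x0 (x0 + l) (a + 2 * l))
      by assumption.
    lra. }
  assert (E1 : RInt q a (a + 2 * l) = 1 * RInt (fun x => h' x ^ 2) a (a + 2 * l)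
     + (- k ^ 2) * RInt (fun x => w x ^ 2) a (a + 2 * l) + 0 * RInt (fun _ => 0) a (a + 2 * l)).
  { apply RInt_lin3_eq; [intros; unfold q; ring| | |]; intros; cont. }
  assert (E2 : RInt (fun x => w x ^ 2) a (a + 2 * l) = 1 * RInt (fun x => h x ^ 2) a (a + 2 * l)
     + (- 2 * h x0) * RInt h a (a + 2 * l) + h x0 ^ 2 * RInt (fun _ => 1) a (a + 2 * l)).
  { apply RInt_lin3_eq; [intros; unfold w; ring| | |]; intros; cont. }
  rewrite Em, RInt_const_R in E2.
  (* As [h] has mean zero, the integral of [w ^ 2] exceeds that of [h ^ 2] by this nonnegative
     constant, up to the factor [k ^ 2]. *)
  assert (0 <= k ^ 2 * (h x0 ^ 2 * (2 * l))).
  { apply Rmult_le_pos; [apply pow2_ge_0|]; apply Rmult_le_pos; [apply pow2_ge_0|lra]. }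
  rewrite E1, E2 in B. lra.
Qed.

(** The sharp constant is the limit of the subcritical ones as [e] tends to 0. *)
Lemma wirtinger (h h' : R -> R) (a l : R) :
  0 < l ->
  (forall x, is_derive h x (h' x)) -> (forall x, continuous h' x) ->
  h a = h (a + 2 * l) -> RInt h a (a + 2 * l) = 0 :> R ->
  (PI / l) ^ 2 * RInt (fun x => h x ^ 2) a (a + 2 * l)
  <= RInt (fun x => h' x ^ 2) a (a + 2 * l).
Proof.
  intros Hl Hh Hh' Ep Em.
  pose proof (fun e He => wirtinger_subcritical h h' a l e Hl He Hh Hh' Ep Em) as W.
  set (X := RInt (fun x => h x ^ 2) a (a + 2 * l)) in *.
  set (Y := RInt (fun x => h' x ^ 2) a (a + 2 * l)) in *.
  assert (HX : 0 <= X).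
  { apply RInt_nonneg; [lra| |]; intros; [cont|apply pow2_ge_0]. }
  set (K := (PI / l) ^ 2 * X).
  assert (HK : 0 <= K) by (apply Rmult_le_pos; [apply pow2_ge_0|assumption]).
  apply le_epsilon; intros eps Heps.
  (* With this choice [K * (1 - e) ^ 2 >= K - 2 * e * K >= K - eps]. *)
  set (e := Rmin (/ 2) (eps / (2 * (K + 1)))).
  assert (He : 0 < e < 1).
  { split.
    - apply Rmin_pos; [lra|apply Rdiv_lt_0_compat; lra].
    - apply Rle_lt_trans with (/ 2); [apply Rmin_l|lra]. }
  assert (He2 : 2 * e * (K + 1) <= eps).
  { replace eps with (2 * (eps / (2 * (K + 1))) * (K + 1)) at 1 by (field; lra).
    apply Rmult_le_compat_r; [lra|]; apply Rmult_le_compat_l; [lra|apply Rmin_r]. }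
  specialize (W e He).
  replace ((PI / l * (1 - e)) ^ 2 * X) with (K * (1 - e) ^ 2) in W by (unfold K; ring).
  nra.
Qed.

Lemma wirtinger_full_period (h h' : R -> R) :
  (forall x, is_derive h x (h' x)) -> (forall x, continuous h' x) ->
  h 0 = h (2 * PI) -> RInt h 0 (2 * PI) = 0 :> R ->
  RInt (fun x => h x ^ 2) 0 (2 * PI) <= RInt (fun x => h' x ^ 2) 0 (2 * PI).
Proof.
  intros Hh Hh' Ep Em; pose proof PI_RGT_0.
  generalize (wirtinger h h' 0 PI ltac:(assumption) Hh Hh').
  replace (0 + 2 * PI) with (2 * PI) by ring.
  replace (PI / PI) with 1 by (field; lra).
  intros W; specialize (W Ep Em); lra.
Qed.

Lemma wirtinger_half_period (h h' : R -> R) :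
  (forall x, is_derive h x (h' x)) -> (forall x, continuous h' x) ->
  h 0 = h PI -> RInt h 0 PI = 0 :> R ->
  4 * RInt (fun x => h x ^ 2) 0 PI <= RInt (fun x => h' x ^ 2) 0 PI.
Proof.
  intros Hh Hh' Ep Em; pose proof PI_RGT_0.
  generalize (wirtinger h h' 0 (PI / 2) ltac:(lra) Hh Hh').
  replace (0 + 2 * (PI / 2)) with PI by field.
  replace (PI / (PI / 2)) with 2 by (field; lra).
  intros W; specialize (W Ep Em); lra.
Qed.

(** * The fourth-order inequality *)

Lemma RInt_by_parts_periodic (f f' f'' : R -> R) (a b : R) :
  (forall x, is_derive f x (f' x)) -> (forall x, is_derive f' x (f'' x)) ->
  (forall x, continuous f'' x) ->
  f a = f b -> f' a = f' b ->
  RInt (fun x => f x * f'' x) a b = - RInt (fun x => f' x ^ 2) a b.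
Proof.
  intros Hf Hf' Hf'' E E'.
  assert (P : RInt (fun x => f' x ^ 2 + f x * f'' x) a b = f b * f' b - f a * f' a).
  { apply (RInt_primitive (fun x => f x * f' x)).
    - intros x; derive_from_hyps; ring.
    - intros x; cont. }
  rewrite (RInt_lin3_eq (fun x => f' x ^ 2 + f x * f'' x) (fun x => f' x ^ 2)
             (fun x => f x * f'' x) (fun _ => 0) 1 1 0) in P;
    [|intros; ring|intros; cont ..].
  rewrite E, E' in P; lra.
Qed.

(* On a mode of frequency [n] the right-hand integrand weighs
   [(n^2 - 1) (n^2 - 4) = (n^2 - 4)^2 + 3 (n^2 - 4)]. *)
Lemma fourth_order_half_period (g g' g'' : R -> R) (m : R) :
  (forall x, is_derive g x (g' x)) -> (forall x, is_derive g' x (g'' x)) ->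
  (forall x, continuous g'' x) ->
  g 0 = g PI -> g' 0 = g' PI -> RInt g 0 PI = PI * m :> R ->
  RInt (fun x => (g'' x + 4 * (g x - m)) ^ 2) 0 PI
  <= RInt (fun x => g'' x ^ 2 - 5 * g' x ^ 2 + 4 * (g x - m) ^ 2) 0 PI.
Proof.
  intros Hg Hg' Hg'' E E' Em.
  set (f := fun x => g x - m).
  assert (Hf : forall x, is_derive f x (g' x)).
  { intros x; unfold f; derive_from_hyps; ring. }
  assert (Hfg : f 0 = f PI) by (unfold f; rewrite E; ring).
  assert (Hf0 : RInt f 0 PI = 0 :> R).
  { rewrite (RInt_lin3_eq f g (fun _ => 1) (fun _ => 0) 1 (- m) 0);
      [|intros; unfold f; ring|intros; cont ..].
    rewrite Em, !RInt_const_R; ring. }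
  assert (Hg'c : forall x, continuous g' x) by (intros; cont).
  pose proof (wirtinger_half_period f g' Hf Hg'c Hfg Hf0) as W.
  pose proof (RInt_by_parts_periodic f g' g'' 0 PI Hf Hg' Hg'' Hfg E') as P.
  rewrite (RInt_lin3_eq (fun x => (g'' x + 4 * (g x - m)) ^ 2) (fun x => g'' x ^ 2)
             (fun x => f x * g'' x) (fun x => f x ^ 2) 1 8 16);
    [|intros; unfold f; ring|intros; cont ..].
  rewrite (RInt_lin3_eq (fun x => g'' x ^ 2 - 5 * g' x ^ 2 + 4 * (g x - m) ^ 2)
             (fun x => g'' x ^ 2) (fun x => g' x ^ 2) (fun x => f x ^ 2) 1 (-5) 4);
    [|intros; unfold f; ring|intros; cont ..].
  (* The right side minus the left side is three times the gap in [W]. *)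
  lra.
Qed.

(** * Vanishing integrals and the oscillator equation *)

Lemma RInt_nonneg_zero (f : R -> R) (a b : R) :
  (forall x, continuous f x) -> (forall x, 0 <= f x) -> RInt f a b <= 0 ->
  forall x, a < x < b -> f x = 0.
Proof.
  intros Hf H0 HI x Hx.
  destruct (Rle_lt_or_eq_dec 0 (f x) (H0 x)) as [Hpos|]; [exfalso|auto].
  destruct (proj1 (continuity_pt_locally f x)
    (proj2 (continuity_pt_filterlim f x) (Hf x)) (mkposreal (f x / 2) ltac:(lra))) as [d Hd].
  simpl in Hd.
  set (u := Rmin b (x + d / 2)).
  pose proof (cond_pos d).
  assert (Hu : x < u <= b /\ u <= x + d / 2).
  { unfold u; repeat split; [apply Rmin_glb_lt; lra|apply Rmin_l|apply Rmin_r]. }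
  assert (Hxu : (u - x) * (f x / 2) <= RInt f x u).
  { rewrite <- RInt_const_R; apply RInt_le; [lra| | |].
    - apply ex_RInt_const.
    - now apply ex_RInt_cont.
    - intros y Hy.
      assert (B : Rabs (y - x) < d) by (rewrite Rabs_right; lra).
      specialize (Hd y B); apply Rabs_def2 in Hd; lra. }
  rewrite (RInt_Chasles_cont f a x b), (RInt_Chasles_cont f x u b) in HI by assumption.
  assert (0 <= RInt f a x) by (apply RInt_nonneg; auto; lra).
  assert (0 <= RInt f u b) by (apply RInt_nonneg; auto; lra).
  assert (0 < (u - x) * (f x / 2)) by (apply Rmult_lt_0_compat; lra).
  lra.
Qed.

Lemma constant_of_zero_derivative (F F' : R -> R) (a b : R) :
  (forall x, is_derive F x (F' x)) -> (forall x, a < x < b -> F' x = 0) ->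
  forall x, a <= x <= b -> F x = F a.
Proof.
  intros HF H0 x Hx.
  destruct (Req_dec x a) as [->|Hxa]; [reflexivity|].
  destruct (MVT_cor2 F F' a x ltac:(lra)) as [y [Ey Hy]].
  - intros y _; apply is_derive_Reals; apply HF.
  - rewrite H0 in Ey by lra; lra.
Qed.

(** Rotating the phase vector [(f, f' / 2)] through the angle [2 * x] gives two first integrals [F]
    and [G], whose values at [a] are the amplitudes. *)
Lemma oscillator_solution (f f' f'' : R -> R) (a b : R) :
  (forall x, is_derive f x (f' x)) -> (forall x, is_derive f' x (f'' x)) ->
  (forall x, a < x < b -> f'' x + 4 * f x = 0) ->
  exists A B, forall x, a <= x <= b -> f x = A * cos (2 * x) + B * sin (2 * x).
Proof.
  intros Hf Hf' H0.
  set (F := fun x => f x * cos (2 * x) - f' x / 2 * sin (2 * x)).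
  set (G := fun x => f x * sin (2 * x) + f' x / 2 * cos (2 * x)).
  assert (HF : forall x, a <= x <= b -> F x = F a).
  { apply constant_of_zero_derivative
      with (fun x => - (f'' x + 4 * f x) * sin (2 * x) / 2).
    - intros x; unfold F; derive_from_hyps; field.
    - intros x Hx; rewrite H0 by assumption; field. }
  assert (HG : forall x, a <= x <= b -> G x = G a).
  { apply constant_of_zero_derivative
      with (fun x => (f'' x + 4 * f x) * cos (2 * x) / 2).
    - intros x; unfold G; derive_from_hyps; field.
    - intros x Hx; rewrite H0 by assumption; field. }
  exists (F a), (G a); intros x Hx.
  rewrite <- (HF x Hx), <- (HG x Hx); unfold F, G.
  generalize (sin2_cos2 (2 * x)); unfold Rsqr; intros E.
  transitivity (f x * (sin (2 * x) * sin (2 * x) + cos (2 * x) * cos (2 * x)));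
    [rewrite E|]; ring.
Qed.

(** * Periodic functions and folding onto a half period *)

Lemma derive_periodic (f f' : R -> R) (s : R) :
  (forall x, f (x + s) = f x) -> (forall x, is_derive f x (f' x)) ->
  forall x, f' (x + s) = f' x.
Proof.
  intros Hs Hf x.
  rewrite <- (is_derive_unique f x _ (Hf x)).
  symmetry; apply is_derive_unique.
  apply is_derive_ext with (fun y => f (y + s)); [exact Hs|].
  derive_from_hyps; ring.
Qed.

Lemma periodic_IZR (f : R -> R) (s : R) :
  (forall x, f (x + s) = f x) -> forall (k : Z) x, f (x + IZR k * s) = f x.
Proof.
  intros Hs.
  assert (N : forall (n : nat) x, f (x + INR n * s) = f x).
  { induction n as [|n IH]; intros x.
    - simpl; f_equal; ring.
    - rewrite S_INR; replace (x + (INR n + 1) * s) with (x + INR n * s + s) by ring.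
      rewrite Hs; apply IH. }
  intros k x; destruct (Z_le_gt_dec 0 k) as [Hk|Hk].
  - rewrite <- (Z2Nat.id k Hk), <- INR_IZR_INZ; apply N.
  - rewrite <- (N (Z.to_nat (- k)) (x + IZR k * s)), INR_IZR_INZ, Z2Nat.id by lia.
    f_equal; rewrite opp_IZR; ring.
Qed.

Lemma eq_of_eq_on_period (f g : R -> R) (s : R) :
  0 < s -> (forall x, f (x + s) = f x) -> (forall x, g (x + s) = g x) ->
  (forall x, 0 <= x <= s -> f x = g x) -> forall x, f x = g x.
Proof.
  intros Hs Hf Hg E x.
  (* [up] is the floor plus one, so [k] is minus the floor of [x / s] and [x + k s] lies in
     [[0, s)]. *)
  set (k := (1 - up (x / s))%Z).
  rewrite <- (periodic_IZR f s Hf k), <- (periodic_IZR g s Hg k).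
  apply E; unfold k; rewrite minus_IZR.
  destruct (archimed (x / s)) as [U V].
  assert (x = x / s * s) by (field; lra).
  split; nra.
Qed.

Lemma RInt_fold_half_period (f : R -> R) :
  (forall x, continuous f x) ->
  RInt f 0 (2 * PI) = RInt (fun x => f x + f (x + PI)) 0 PI :> R.
Proof.
  intros Hf.
  rewrite (RInt_lin3_eq (fun x => f x + f (x + PI)) f (fun x => f (x + PI)) (fun _ => 0) 1 1 0);
    [|intros; ring|intros; cont ..].
  rewrite (RInt_Chasles_cont f 0 PI (2 * PI)), RInt_const_R by assumption.
  assert (E : RInt (fun x => f (x + PI)) 0 PI = RInt f PI (2 * PI) :> R).
  { pose proof (RInt_comp_lin (V := R_CompleteNormedModule) f 1 PI 0 PI
                  (ex_RInt_cont f _ _ Hf)) as C.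
    replace (1 * 0 + PI) with PI in C by ring.
    replace (1 * PI + PI) with (2 * PI) in C by ring.
    rewrite <- C; apply RInt_ext; intros x _.
    transitivity (1 * f (1 * x + PI)); [rewrite !Rmult_1_l|]; reflexivity. }
  rewrite E; ring.
Qed.

(** * The quadratic form on the PI-periodic and PI-antiperiodic parts *)

Section FourthOrder.

Variables (p p' p'' : R -> R).
Hypothesis p_per : forall x, p (x + 2 * PI) = p x.
Hypothesis p_der : forall x, is_derive p x (p' x).
Hypothesis p'_der : forall x, is_derive p' x (p'' x).
Hypothesis p''_cont : forall x, continuous p'' x.

Let m : R := RInt p 0 (2 * PI) / (2 * PI).
(** [a] and [b] are the value and the slope at 0 of the PI-antiperiodic part of [p]. *)
Let a := (p 0 - p PI) / 2.
Let b := (p' 0 - p' PI) / 2.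

Let e x := (p x + p (x + PI)) / 2.
Let e' x := (p' x + p' (x + PI)) / 2.
Let e'' x := (p'' x + p'' (x + PI)) / 2.

(* Removing the first harmonic makes this PI-antiperiodic function vanish to
   first order at 0 and PI, so that on [0, PI] it also matches at both ends. *)
Let q x := (p x - p (x + PI)) / 2 - a * cos x - b * sin x.
Let q' x := (p' x - p' (x + PI)) / 2 + a * sin x - b * cos x.
Let q'' x := (p'' x - p'' (x + PI)) / 2 + a * cos x + b * sin x.

(** The shift [k] is free because two values matter for [q]: splitting [p] yields 0, whereas
    Wirtinger's inequality on [[0, PI]] requires the mean over that interval. *)
Let form (f f' f'' : R -> R) (k : R) (x : R) := f'' x ^ 2 - 5 * f' x ^ 2 + 4 * (f x - k) ^ 2.

Let p'_per : forall x, p' (x + 2 * PI) = p' x.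
Proof. exact (derive_periodic p p' _ p_per p_der). Qed.

Let e_der : forall x, is_derive e x (e' x).
Proof. intros x; unfold e, e'; derive_from_hyps; field. Qed.

Let e'_der : forall x, is_derive e' x (e'' x).
Proof. intros x; unfold e', e''; derive_from_hyps; field. Qed.

Let e''_cont : forall x, continuous e'' x.
Proof. intros x; unfold e''; cont. Qed.

Let q_der : forall x, is_derive q x (q' x).
Proof. intros x; unfold q, q'; derive_from_hyps; field. Qed.

Let q'_der : forall x, is_derive q' x (q'' x).
Proof. intros x; unfold q', q''; derive_from_hyps; field. Qed.

Let q''_cont : forall x, continuous q'' x.
Proof. intros x; unfold q''; cont. Qed.

Let e_ends : e 0 = e PI.
Proof.
  unfold e; replace (PI + PI) with (0 + 2 * PI) by ring; rewrite p_per, Rplus_0_l; field.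
Qed.

Let e'_ends : e' 0 = e' PI.
Proof.
  unfold e'; replace (PI + PI) with (0 + 2 * PI) by ring; rewrite p'_per, Rplus_0_l; field.
Qed.

Let q_ends : q 0 = 0 /\ q PI = 0 /\ q' 0 = 0 /\ q' PI = 0.
Proof.
  unfold q, q', a, b; replace (PI + PI) with (0 + 2 * PI) by ring.
  rewrite p_per, p'_per, !Rplus_0_l, cos_0, sin_0, cos_PI, sin_PI.
  repeat split; field.
Qed.

Let p_cont : forall x, continuous p x.
Proof. intros; cont. Qed.
Let p'_cont : forall x, continuous p' x.
Proof. intros; cont. Qed.

Let e_mean : RInt e 0 PI = PI * m :> R.
Proof.
  unfold m; rewrite (RInt_fold_half_period p p_cont).
  rewrite (RInt_lin3_eq e (fun x => p x + p (x + PI)) (fun _ => 0) (fun _ => 0) (/ 2) 0 0);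
    [|intros; unfold e; field|intros; cont ..].
  rewrite !RInt_const_R; field; apply PI_neq0.
Qed.

(** Adding the values at [x] and [x + PI] removes the cross terms between the two parts. What the
    first harmonic [s] adds to the form of [q] is an exact derivative with equal boundary values. *)
Let form_split :
  RInt (form p p' p'' m) 0 (2 * PI)
  = 2 * (RInt (form e e' e'' m) 0 PI + RInt (form q q' q'' 0) 0 PI) :> R.
Proof.
  set (s x := a * cos x + b * sin x).
  set (s' x := - a * sin x + b * cos x).
  (* [D] is the form of [q + s] minus the form of [q], both with shift 0, using [s'' = - s]. *)
  set (D x := (q'' x - s x) ^ 2 - q'' x ^ 2 - 5 * (2 * q' x * s' x + s' x ^ 2)
              + 4 * (2 * q x * s x + s x ^ 2)).
  assert (s_der : forall x, is_derive s x (s' x)).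
  { intros x; unfold s, s'; derive_from_hyps; ring. }
  assert (s'_der : forall x, is_derive s' x (- s x)).
  { intros x; unfold s, s'; derive_from_hyps; ring. }
  assert (D_cont : forall x, continuous D x).
  { intros x; unfold D; cont. }
  assert (D_int : RInt D 0 PI = 0 :> R).
  { rewrite (RInt_primitive (fun x => - 5 * s x * s' x - 2 * q' x * s x - 8 * q x * s' x) D);
      [|intros x; unfold D; derive_from_hyps; ring|assumption].
    (* Only the term [- 5 * s * s'] of the primitive survives at the ends, and [s] and [s'] both
       change sign from 0 to PI. *)
    destruct q_ends as (-> & -> & -> & ->).
    unfold s, s'; rewrite cos_0, sin_0, cos_PI, sin_PI; ring. }
  rewrite RInt_fold_half_period by (intros; unfold form; cont).
  rewrite (RInt_lin3_eq (fun x => form p p' p'' m x + form p p' p'' m (x + PI))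
             (form e e' e'' m) (form q q' q'' 0) D 2 2 2).
  - rewrite D_int; ring.
  - intros x; unfold form, D, s, s', e, e', e'', q, q', q''; field.
  - intros; unfold form; cont.
  - intros; unfold form; cont.
  - assumption.
Qed.

Let q_mean : R := RInt q 0 PI / PI.

(** Recentring at the mean leaves a nonnegative surplus, which in the equality case forces
    [q_mean = 0]. *)
Let form_q :
  RInt (form q q' q'' 0) 0 PI = RInt (form q q' q'' q_mean) 0 PI + 4 * PI * q_mean ^ 2 :> R.
Proof.
  rewrite (RInt_lin3_eq (form q q' q'' 0) (form q q' q'' q_mean) q (fun _ => 1)
             1 (8 * q_mean) (- 4 * q_mean ^ 2));
    [|intros; unfold form; ring|intros; unfold form; cont ..].
  rewrite RInt_const_R.
  assert (E : RInt q 0 PI = PI * q_mean :> R) by (unfold q_mean; symmetry; field; apply PI_neq0).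
  rewrite E; ring.
Qed.

Let e_bound :
  RInt (fun x => (e'' x + 4 * (e x - m)) ^ 2) 0 PI <= RInt (form e e' e'' m) 0 PI.
Proof. now apply fourth_order_half_period. Qed.

Let q_bound :
  RInt (fun x => (q'' x + 4 * (q x - q_mean)) ^ 2) 0 PI <= RInt (form q q' q'' q_mean) 0 PI.
Proof.
  destruct q_ends as (q0 & q1 & q'0 & q'1).
  apply fourth_order_half_period; try assumption.
  - congruence.
  - congruence.
  - unfold q_mean; symmetry; field; apply PI_neq0.
Qed.

Let e_square_nonneg : 0 <= RInt (fun x => (e'' x + 4 * (e x - m)) ^ 2) 0 PI.
Proof.
  pose proof PI_RGT_0.
  apply RInt_nonneg; [lra|intros; cont|intros; apply pow2_ge_0].
Qed.

Let q_square_nonneg : 0 <= RInt (fun x => (q'' x + 4 * (q x - q_mean)) ^ 2) 0 PI.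
Proof.
  pose proof PI_RGT_0.
  apply RInt_nonneg; [lra|intros; cont|intros; apply pow2_ge_0].
Qed.

Let q_mean_nonneg : 0 <= 4 * PI * q_mean ^ 2.
Proof.
  pose proof PI_RGT_0.
  apply Rmult_le_pos; [lra|apply pow2_ge_0].
Qed.

Lemma fourth_order_nonneg :
  0 <= RInt (fun x => p'' x ^ 2 - 5 * p' x ^ 2 + 4 * (p x - m) ^ 2) 0 (2 * PI).
Proof.
  change (0 <= RInt (form p p' p'' m) 0 (2 * PI)).
  rewrite form_split, form_q; lra.
Qed.

(** The integral dominates a positive multiple of each of three nonnegative quantities: the two
    integrated squares and the surplus in [q_mean]. All must vanish; then [e - m] is a second
    harmonic and [q] is zero, so the antiperiodic part is the first harmonic with coefficients [a]
    and [b]. *)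
Lemma fourth_order_equality :
  RInt (fun x => p'' x ^ 2 - 5 * p' x ^ 2 + 4 * (p x - m) ^ 2) 0 (2 * PI) = 0 ->
  exists a0 a1 b1 a2 b2 : R, forall x,
    p x = a0 + a1 * cos x + b1 * sin x + a2 * cos (2 * x) + b2 * sin (2 * x).
Proof.
  change (RInt (form p p' p'' m) 0 (2 * PI) = 0 ->
          exists a0 a1 b1 a2 b2 : R, forall x,
            p x = a0 + a1 * cos x + b1 * sin x + a2 * cos (2 * x) + b2 * sin (2 * x)).
  pose proof PI_RGT_0 as HPI.
  rewrite form_split, form_q; intros H0.
  assert (Hmean : q_mean = 0).
  { assert (Z : 4 * PI * q_mean ^ 2 = 0) by lra.
    apply Rmult_integral in Z; destruct Z as [Z|Z]; [lra|nra]. }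
  assert (He : forall x, 0 < x < PI -> e'' x + 4 * (e x - m) = 0).
  { intros x Hx.
    apply (Rsqr_0_uniq (e'' x + 4 * (e x - m))); rewrite Rsqr_pow2.
    apply (RInt_nonneg_zero (fun x => (e'' x + 4 * (e x - m)) ^ 2) 0 PI);
      [intros; cont|intros; apply pow2_ge_0|lra|assumption]. }
  assert (Hq : forall x, 0 < x < PI -> q'' x + 4 * q x = 0).
  { intros x Hx.
    replace (q'' x + 4 * q x) with (q'' x + 4 * (q x - q_mean)) by (rewrite Hmean; ring).
    apply (Rsqr_0_uniq (q'' x + 4 * (q x - q_mean))); rewrite Rsqr_pow2.
    apply (RInt_nonneg_zero (fun x => (q'' x + 4 * (q x - q_mean)) ^ 2) 0 PI);
      [intros; cont|intros; apply pow2_ge_0|lra|assumption]. }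
  destruct (oscillator_solution (fun x => e x - m) e' e'' 0 PI) as (A & B & HAB).
  { intros x; derive_from_hyps; ring. }
  { assumption. }
  { assumption. }
  assert (Hq0 : forall x, 0 <= x <= PI -> q x = 0).
  (* [N] is the conserved energy of [q'' + 4 q = 0]; it is zero at 0, where [q] vanishes to first
     order. *)
  { set (N x := q' x ^ 2 + 4 * q x ^ 2).
    destruct q_ends as (q0 & _ & q'0 & _).
    assert (HN : forall x, 0 <= x <= PI -> N x = N 0).
    { apply constant_of_zero_derivative with (fun x => 2 * q' x * (q'' x + 4 * q x)).
      - intros x; unfold N; derive_from_hyps; ring.
      - intros x Hx; rewrite Hq by assumption; ring. }
    intros x Hx; specialize (HN x Hx); unfold N in HN; rewrite q0, q'0 in HN.
    generalize (pow2_ge_0 (q' x)) (pow2_ge_0 (q x)); nra. }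
  exists m, a, b, A, B.
  apply eq_of_eq_on_period with (2 * PI).
  - lra.
  - exact p_per.
  - intros x.
    replace (2 * (x + 2 * PI)) with (2 * x + 2 * PI + 2 * PI) by ring.
    rewrite !cos_plus, !sin_plus, cos_2PI, sin_2PI; ring.
  (* A shift by PI keeps the second harmonics and reverses the first, so [[0, PI]] determines the
     whole period. *)
  - assert (Half : forall x, 0 <= x <= PI ->
      p x = m + a * cos x + b * sin x + A * cos (2 * x) + B * sin (2 * x) /\
      p (x + PI) = m - a * cos x - b * sin x + A * cos (2 * x) + B * sin (2 * x)).
    { intros x Hx; specialize (HAB x Hx); specialize (Hq0 x Hx).
      unfold e in HAB; unfold q in Hq0; split; lra. }
    intros x Hx; destruct (Rle_dec x PI) as [Hx'|Hx'].
    + apply Half; lra.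
    + destruct (Half (x - PI) ltac:(lra)) as [_ E].
      replace (x - PI + PI) with x in E by ring.
      rewrite E.
      replace (cos (x - PI)) with (- cos x)
        by (rewrite cos_minus, cos_PI, sin_PI; ring).
      replace (sin (x - PI)) with (- sin x)
        by (rewrite sin_minus, cos_PI, sin_PI; ring).
      replace (2 * (x - PI)) with (2 * x - 2 * PI) by ring.
      rewrite cos_minus, sin_minus, cos_2PI, sin_2PI; ring.
Qed.

End FourthOrder.

(** * Regularity of the support function *)

Lemma class_C2_derivatives (f : R -> R) :
  class_C2 f ->
  (forall t, is_derive f t (Derive f t)) /\
  (forall t, is_derive (Derive f) t (Derive_n f 2 t)) /\
  (forall t, continuous (Derive_n f 2) t).
Proof.
  intros Hf; split; [|split]; intros t; destruct (Hf t) as (D1 & D2 & D3).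
  - now apply Derive_correct.
  - exact (Derive_correct _ _ D2).
  - exact D3.
Qed.

Lemma zero_derivative_constant (F : R -> R) :
  (forall x, is_derive F x 0) -> forall x y, F x = F y.
Proof.
  intros HF x y.
  rewrite (constant_of_zero_derivative F (fun _ => 0) (Rmin x y) (Rmax x y) HF ltac:(auto) x),
    (constant_of_zero_derivative F (fun _ => 0) (Rmin x y) (Rmax x y) HF ltac:(auto) y);
    [reflexivity|split; [apply Rmin_r|apply Rmax_r]|split; [apply Rmin_l|apply Rmax_l]].
Qed.

Lemma is_derive_minimum (f : R -> R) (x l : R) :
  is_derive f x l -> (forall y, f x <= f y) -> l = 0.
Proof.
  intros Hf Hmin; apply is_derive_Reals in Hf.
  pose (pr := exist _ l Hf : derivable_pt f x).
  exact (deriv_minimum f (x - 1) (x + 1) x pr ltac:(lra) ltac:(lra) (fun y _ _ => Hmin y)).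
Qed.

Lemma is_derive_increasing (f f' : R -> R) :
  (forall x, is_derive f x (f' x)) -> (forall x, 0 < f' x) ->
  forall x y, x < y -> f x < f y.
Proof.
  intros Hf Hpos x y Hxy.
  destruct (MVT_cor2 f f' x y Hxy) as [z [E _]].
  - intros z _; apply is_derive_Reals; apply Hf.
  - assert (0 < f' z * (y - x)) by (apply Rmult_lt_0_compat; [apply Hpos|lra]); lra.
Qed.

(** By the intermediate value theorem [h] is open. Local statements thus pass through [h] without
    constructing its inverse. *)
Lemma locally_increasing_image (h : R -> R) (t0 : R) (P : R -> Prop) :
  (forall t, continuous h t) -> (forall s t, s < t -> h s < h t) ->
  locally t0 (fun t => P (h t)) -> locally (h t0) P.
Proof.
  intros Hc Hm [d Hd]; pose proof (cond_pos d) as Hd0.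
  pose proof (Hm (t0 - d / 2) t0 ltac:(lra)) as L.
  pose proof (Hm t0 (t0 + d / 2) ltac:(lra)) as U.
  exists (mkposreal (Rmin (h t0 - h (t0 - d / 2)) (h (t0 + d / 2) - h t0))
                    ltac:(apply Rmin_pos; lra)).
  intros z Hz; change (Rabs (z - h t0)
    < Rmin (h t0 - h (t0 - d / 2)) (h (t0 + d / 2) - h t0)) in Hz.
  apply Rabs_def2 in Hz.
  pose proof (Rmin_l (h t0 - h (t0 - d / 2)) (h (t0 + d / 2) - h t0)).
  pose proof (Rmin_r (h t0 - h (t0 - d / 2)) (h (t0 + d / 2) - h t0)).
  destruct (IVT_gen h (t0 - d / 2) (t0 + d / 2) z) as [t [Ht E]].
  - intros t; apply continuity_pt_filterlim; apply Hc.
  - unfold Rmin, Rmax in *; repeat destruct (Rle_dec _ _); lra.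
  - rewrite Rmin_left, Rmax_right in Ht by lra.
    rewrite <- E; apply Hd; change (Rabs (t - t0) < d); apply Rabs_def1; lra.
Qed.

Lemma continuous_reparam (h F : R -> R) (t0 : R) :
  (forall t, continuous h t) -> (forall s t, s < t -> h s < h t) ->
  continuous (fun t => F (h t)) t0 -> continuous F (h t0).
Proof.
  intros Hc Hm HF P HP.
  apply (locally_increasing_image h t0 (fun z => P (F z)) Hc Hm).
  exact (HF P HP).
Qed.

(** Near [t0] the increment of [h] is at least half of [h' t0 * |t - t0|], so an error that is small
    relative to [t - t0] is small relative to [h t - h t0]. *)
Lemma is_derive_reparam (h h' F : R -> R) (t0 l : R) :
  (forall t, is_derive h t (h' t)) -> (forall t, 0 < h' t) ->
  is_derive (fun t => F (h t)) t0 (h' t0 * l) -> is_derive F (h t0) l.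
Proof.
  intros Hh Hpos HF.
  assert (Hinc := is_derive_increasing h h' Hh Hpos).
  split; [apply is_linear_scal_l|].
  intros z Hz; apply (is_filter_lim_locally_unique (V := R_NormedModule)) in Hz.
  subst z; intros eps.
  apply (locally_increasing_image h t0); [intros; cont|assumption|].
  set (d := h' t0); assert (Hd : 0 < d) by apply Hpos.
  (* Subtracting [l * h] reduces the claim to a zero derivative, where only the remainder has to be
     compared. *)
  assert (HG : is_derive (fun t => F (h t) - l * h t) t0 0).
  { replace 0 with (d * l - l * d) by ring.
    apply (is_derive_minus (fun t => F (h t)) (fun t => l * h t)); [exact HF|].
    apply (is_derive_scal h t0 l d (Hh t0)). }
  pose proof (cond_pos eps) as He.
  destruct HG as [_ HG]; specialize (HG t0 (fun P HP => HP)
    (mkposreal (eps * (d / 2)) ltac:(apply Rmult_lt_0_compat; lra))).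
  destruct (Hh t0) as [_ Hh0]; specialize (Hh0 t0 (fun P HP => HP)
    (mkposreal (d / 2) ltac:(lra))).
  generalize (filter_and _ _ HG Hh0); apply filter_imp; clear HG Hh0.
  unfold norm, minus, plus, opp, scal; simpl; unfold abs, mult; simpl.
  intros t [G1 G2].
  change (Rabs (F (h t) - l * h t + - (F (h t0) - l * h t0) + - ((t + - t0) * 0))
          <= eps * (d / 2) * Rabs (t + - t0)) in G1.
  change (Rabs (h t + - h t0 + - ((t + - t0) * d)) <= d / 2 * Rabs (t + - t0)) in G2.
  change (Rabs (F (h t) + - F (h t0) + - ((h t + - h t0) * l)) <= eps * Rabs (h t + - h t0)).
  assert (B : d / 2 * Rabs (t + - t0) <= Rabs (h t + - h t0)).
  { pose proof (Rabs_triang (h t + - h t0) (- (h t + - h t0 + - ((t + - t0) * d)))) as Tr.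
    rewrite Rabs_Ropp in Tr.
    replace (h t + - h t0 + - (h t + - h t0 + - ((t + - t0) * d)))
      with ((t + - t0) * d) in Tr by ring.
    rewrite Rabs_mult, (Rabs_right d) in Tr by lra; lra. }
  replace (F (h t) + - F (h t0) + - ((h t + - h t0) * l))
    with (F (h t) - l * h t + - (F (h t0) - l * h t0) + - ((t + - t0) * 0)) by ring.
  apply Rle_trans with (1 := G1).
  rewrite Rmult_assoc; apply Rmult_le_compat_l; lra.
Qed.

(** The unit normal turns at angular speed [k], so its angle is the integral of [k] started at
    [theta0]. *)
Lemma normal_angle_lift (x1 y1 x2 y2 v : R -> R) (t0 theta0 : R) :
  (forall t, is_derive x1 t (x2 t)) -> (forall t, is_derive y1 t (y2 t)) ->
  (forall t, continuous x2 t) -> (forall t, continuous y2 t) ->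
  (forall t, v t = sqrt (x1 t ^ 2 + y1 t ^ 2)) -> (forall t, 0 < v t) ->
  y1 t0 / v t0 = cos theta0 -> - x1 t0 / v t0 = sin theta0 ->
  exists h : R -> R,
    h t0 = theta0 /\
    (forall t, is_derive h t ((x1 t * y2 t - y1 t * x2 t) / v t ^ 2)) /\
    forall t, y1 t / v t = cos (h t) /\ - x1 t / v t = sin (h t).
Proof.
  intros Hx Hy Hx2 Hy2 Ev Hv Ec Es.
  assert (Hsq : forall t, v t ^ 2 = x1 t ^ 2 + y1 t ^ 2).
  { intros t; rewrite Ev, <- Rsqr_pow2; apply Rsqr_sqrt.
    generalize (pow2_ge_0 (x1 t)) (pow2_ge_0 (y1 t)); lra. }
  assert (Hv' : forall t, is_derive v t ((x1 t * x2 t + y1 t * y2 t) / v t)).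
  { intros t; apply is_derive_ext with (fun t => sqrt (x1 t ^ 2 + y1 t ^ 2)).
    - intros; symmetry; apply Ev.
    - pose proof (Hv t) as Hvt; rewrite Ev in Hvt |- *.
      assert (0 < x1 t ^ 2 + y1 t ^ 2) by (rewrite <- Hsq; apply pow_lt, Hv).
      auto_derive.
      + repeat split; deriv_side; try assumption.
      + deriv_values; simpl in *; field; simpl; lra. }
  set (k t := (x1 t * y2 t - y1 t * x2 t) / v t ^ 2).
  assert (Hk : forall t, continuous k t).
  { intros t; unfold k.
    apply (continuous_mult (fun t => x1 t * y2 t - y1 t * x2 t) (fun t => / v t ^ 2)).
    - cont.
    - apply (continuous_comp (fun t => v t ^ 2) Rinv); [cont|].
      apply continuity_pt_filterlim, continuity_pt_inv; [apply continuity_pt_id|].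
      apply pow_nonzero; generalize (Hv t); lra. }
  set (h := fun t : R => theta0 + RInt k t0 t).
  exists h.
  assert (Hh : forall t, is_derive h t (k t)).
  { intros t; replace (k t) with (0 + k t) by ring.
    apply (is_derive_plus (fun _ => theta0) (fun t => RInt k t0 t));
      [apply (is_derive_const theta0)|].
    apply (is_derive_RInt k (fun t => RInt k t0 t) t0 t); [|apply Hk].
    apply filter_forall; intros s.
    apply (@RInt_correct R_CompleteNormedModule), ex_RInt_cont, Hk. }
  assert (h0 : h t0 = theta0).
  { unfold h; rewrite (RInt_point t0 k); apply Rplus_0_r. }
  split; [exact h0|split; [exact Hh|]].
  set (nx t := y1 t / v t); set (ny t := - x1 t / v t).
  assert (Hnx : forall t, is_derive nx t (- k t * ny t)).
  { intros t; pose proof (Hv t); unfold nx, ny, k; auto_derive.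
    - deriv_side; lra.
    - deriv_values; rewrite Hsq.
      field_simplify_eq; [rewrite Hsq; ring|split; [lra|rewrite <- Hsq; apply pow_nonzero; lra]]. }
  assert (Hny : forall t, is_derive ny t (k t * nx t)).
  { intros t; pose proof (Hv t); unfold nx, ny, k; auto_derive.
    - deriv_side; lra.
    - deriv_values; rewrite Hsq.
      field_simplify_eq; [rewrite Hsq; ring|split; [lra|rewrite <- Hsq; apply pow_nonzero; lra]]. }
  (* [a] and [b] are the coordinates of the normal in the frame rotated by [h]; they are constant,
     equal to 1 and 0 by their values at [t0]. *)
  set (a t := nx t * cos (h t) + ny t * sin (h t)).
  set (b t := ny t * cos (h t) - nx t * sin (h t)).
  assert (Ha : forall t, is_derive a t 0).
  { intros t; unfold a; derive_from_hyps; ring. }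
  assert (Hb : forall t, is_derive b t 0).
  { intros t; unfold b; derive_from_hyps; ring. }
  intros t.
  pose proof (zero_derivative_constant a Ha t t0) as Ea.
  pose proof (zero_derivative_constant b Hb t t0) as Eb.
  unfold a, b in Ea, Eb; rewrite h0 in Ea, Eb.
  replace (nx t0) with (cos theta0) in Ea, Eb; replace (ny t0) with (sin theta0) in Ea, Eb.
  change (nx t = cos (h t) /\ ny t = sin (h t)).
  generalize (sin2_cos2 (h t)) (sin2_cos2 theta0); unfold Rsqr.
  set (C := cos (h t)) in *; set (S := sin (h t)) in *; intros E1 E0.
  split.
  - transitivity ((nx t * C + ny t * S) * C - (ny t * C - nx t * S) * S).
    + transitivity (nx t * (S * S + C * C)); [rewrite E1|]; ring.
    + rewrite Ea, Eb; transitivity ((sin theta0 * sin theta0 + cos theta0 * cos theta0) * C);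
        [|rewrite E0]; ring.
  - transitivity ((nx t * C + ny t * S) * S + (ny t * C - nx t * S) * C).
    + transitivity (ny t * (S * S + C * C)); [rewrite E1|]; ring.
    + rewrite Ea, Eb; transitivity ((sin theta0 * sin theta0 + cos theta0 * cos theta0) * S);
        [|rewrite E0]; ring.
Qed.

(** * The support function as an upper envelope *)

Section SupportFunction.

Variables (c : R -> R * R) (T : R) (gamma : R -> R * R) (rho p : R -> R).
Hypothesis Hc : C2_plus_closed_convex c T.
Hypothesis Hgamma : normal_angle_param c gamma rho.
Hypothesis Hp : is_support_function gamma p.

Let x := xcoord c.
Let y := ycoord c.
Let x' := Derive x.
Let y' := Derive y.
Let x'' := Derive_n x 2.
Let y'' := Derive_n y 2.
Let v := speed c.

Let x_der : forall t, is_derive x t (x' t).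
Proof. exact (proj1 (class_C2_derivatives x (C2p_class_x c T Hc))). Qed.
Let x'_der : forall t, is_derive x' t (x'' t).
Proof. exact (proj1 (proj2 (class_C2_derivatives x (C2p_class_x c T Hc)))). Qed.
Let x''_cont : forall t, continuous x'' t.
Proof. exact (proj2 (proj2 (class_C2_derivatives x (C2p_class_x c T Hc)))). Qed.
Let y_der : forall t, is_derive y t (y' t).
Proof. exact (proj1 (class_C2_derivatives y (C2p_class_y c T Hc))). Qed.
Let y'_der : forall t, is_derive y' t (y'' t).
Proof. exact (proj1 (proj2 (class_C2_derivatives y (C2p_class_y c T Hc)))). Qed.
Let y''_cont : forall t, continuous y'' t.
Proof. exact (proj2 (proj2 (class_C2_derivatives y (C2p_class_y c T Hc)))). Qed.
Let v_pos : forall t, 0 < v t.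
Proof. exact (C2p_regular c T Hc). Qed.
Lemma support_derivative (theta : R) : is_derive p theta (Derive p theta).
Proof. apply Derive_correct, (supp_derivable gamma p Hp). Qed.

Let p_der := support_derivative.

Let normal_at (t theta : R) := y' t / v t = cos theta /\ - x' t / v t = sin theta.

Let velocity_of_normal (t theta : R) :
  normal_at t theta -> x' t = - v t * sin theta /\ y' t = v t * cos theta.
Proof.
  intros [<- <-]; generalize (v_pos t); intros H; split; field; lra.
Qed.

Let curvature_numerator_pos (t : R) : 0 < x' t * y'' t - y' t * x'' t.
Proof.
  pose proof (C2p_curvature c T Hc t) as K.
  assert (0 < v t ^ 3) by apply pow_lt, v_pos.
  replace (x' t * y'' t - y' t * x'' t) with (curvature c t * v t ^ 3).
  - now apply Rmult_lt_0_compat.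
  - unfold curvature; fold x y; fold x' y' x'' y''; fold v.
    field; generalize (v_pos t); lra.
Qed.

(* The curve lies on one side of the tangent at [s]; positive curvature tells
   which, through the second derivative of [tangent_side c s (c t)] at [t = s]. *)
Let tangent_side_nonneg (s t : R) : 0 <= tangent_side c s (c t).
Proof.
  destruct (C2p_convex c T Hc s) as [H|H]; [apply H|exfalso].
  set (f t := x' s * (y t - y s) - y' s * (x t - x s)).
  set (f' t := x' s * y' t - y' s * x' t).
  assert (f_der : forall t, is_derive f t (f' t)).
  { intros u; unfold f, f'; derive_from_hyps; ring. }
  assert (f'_der : is_derive f' s (x' s * y'' s - y' s * x'' s)).
  { unfold f'; derive_from_hyps; ring. }
  assert (f's : f' s = 0) by (unfold f'; ring).
  assert (fs : f s = 0) by (unfold f; ring).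
  set (D := x' s * y'' s - y' s * x'' s) in *.
  assert (HD : 0 < D) by apply curvature_numerator_pos.
  apply is_derive_Reals in f'_der.
  destruct (f'_der (D / 2) ltac:(lra)) as [d Hd]; pose proof (cond_pos d).
  destruct (MVT_cor2 f f' s (s + d / 2) ltac:(lra)) as [z [Ez Hz]].
  { intros u _; apply is_derive_Reals, f_der. }
  assert (Hz' : 0 < f' z).
  { specialize (Hd (z - s) ltac:(lra) ltac:(rewrite Rabs_right; lra)).
    replace (s + (z - s)) with z in Hd by ring; rewrite f's in Hd.
    apply Rabs_def2 in Hd.
    assert (0 < (f' z - 0) / (z - s)) by lra.
    replace (f' z) with ((f' z - 0) / (z - s) * (z - s)) by (field; lra).
    apply Rmult_lt_0_compat; lra. }
  assert (0 < f' z * (s + d / 2 - s)) by (apply Rmult_lt_0_compat; lra).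
  specialize (H (s + d / 2)).
  change (f (s + d / 2) <= 0) in H; lra.
Qed.

(** The gap between the two heights in direction [theta], times the speed at [s], is
    [tangent_side c s (c t)]. *)
Let normal_max (s t theta : R) :
  normal_at s theta -> x t * cos theta + y t * sin theta <= x s * cos theta + y s * sin theta.
Proof.
  intros Hn; destruct (velocity_of_normal s theta Hn) as [Ex Ey].
  pose proof (tangent_side_nonneg s t) as Hs.
  change (0 <= x' s * (y t - y s) - y' s * (x t - x s)) in Hs; rewrite Ex, Ey in Hs.
  generalize (v_pos s); intros Hv.
  assert (0 <= v s * (x s * cos theta + y s * sin theta
                      - (x t * cos theta + y t * sin theta))) by lra.
  nra.
Qed.

Let gamma_point (theta : R) : exists s,
  normal_at s theta /\ rho theta = / curvature c s /\
  x s = p theta * cos theta - Derive p theta * sin theta /\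
  y s = p theta * sin theta + Derive p theta * cos theta.
Proof.
  destruct (Hgamma theta) as (s & Hn & Eg & Er).
  exists s; split; [split|split; [exact Er|split]].
  - exact (f_equal fst Hn).
  - exact (f_equal snd Hn).
  - unfold x, xcoord; rewrite <- Eg, (supp_curve gamma p Hp); reflexivity.
  - unfold y, ycoord; rewrite <- Eg, (supp_curve gamma p Hp); reflexivity.
Qed.

Lemma support_touched (theta : R) : exists s,
  p theta = xcoord c s * cos theta + ycoord c s * sin theta.
Proof.
  destruct (gamma_point theta) as (s & _ & _ & Ex & Ey).
  exists s; fold x y; rewrite Ex, Ey.
  transitivity (p theta * (Rsqr (sin theta) + Rsqr (cos theta)));
    [rewrite sin2_cos2|unfold Rsqr]; ring.
Qed.

Lemma support_upper_bound (t theta : R) :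
  xcoord c t * cos theta + ycoord c t * sin theta <= p theta.
Proof.
  destruct (gamma_point theta) as (s & Hn & _ & Ex & Ey).
  apply Rle_trans with (1 := normal_max s t theta Hn); apply Req_le.
  rewrite Ex, Ey.
  transitivity (p theta * (Rsqr (sin theta) + Rsqr (cos theta)));
    [unfold Rsqr|rewrite sin2_cos2]; ring.
Qed.

(* [p] touches [fun th => <c t, (cos th, sin th)>] from above at [theta], which
   determines [c t] from [p theta] and [p' theta] without any injectivity of
   the normal map. *)
Let touching_point (t theta : R) :
  normal_at t theta ->
  p theta = x t * cos theta + y t * sin theta /\
  Derive p theta = y t * cos theta - x t * sin theta.
Proof.
  intros Hn.
  assert (E : p theta = x t * cos theta + y t * sin theta).
  { destruct (support_touched theta) as [s E]; fold x y in E.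
    apply Rle_antisym; [rewrite E; now apply normal_max|apply support_upper_bound]. }
  split; [exact E|].
  assert (Hm : is_derive (fun th => p th - (x t * cos th + y t * sin th)) theta
                 (Derive p theta - (y t * cos theta - x t * sin theta))).
  { derive_from_hyps; ring. }
  apply is_derive_minimum in Hm; [lra|].
  intros th; rewrite <- E.
  pose proof (support_upper_bound t th) as B; fold x y in B; lra.
Qed.

Let normal_lift (t0 theta : R) :
  normal_at t0 theta ->
  exists h : R -> R,
    h t0 = theta /\ (forall t, is_derive h t (curvature c t * v t)) /\
    (forall t, normal_at t (h t)).
Proof.
  intros [Ec Es].
  destruct (normal_angle_lift x' y' x'' y'' v t0 theta) as (h & h0 & h_der & Hh); auto.
  exists h; split; [exact h0|split; [|exact Hh]].
  intros t; replace (curvature c t * v t) with ((x' t * y'' t - y' t * x'' t) / v t ^ 2);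
    [apply h_der|].
  unfold curvature; fold x y; fold x' y' x'' y''; fold v.
  field; generalize (v_pos t); lra.
Qed.

Let lift_speed_pos (t : R) : 0 < curvature c t * v t.
Proof. apply Rmult_lt_0_compat; [apply (C2p_curvature c T Hc)|apply v_pos]. Qed.

(** Along the lift, [p'] is [y cos h - x sin h], whose derivative at [t0] is
    [v - curvature * v * p]; dividing by the speed [curvature * v] of [h] gives the value. *)
Let second_derivative_at (t0 theta : R) :
  normal_at t0 theta -> is_derive (Derive p) theta (/ curvature c t0 - p theta).
Proof.
  intros Hn.
  destruct (normal_lift t0 theta Hn) as (h & h0 & h_der & Hh).
  rewrite <- h0 at 1.
  apply (is_derive_reparam h _ _ t0 _ h_der lift_speed_pos).
  apply is_derive_ext with (fun t => y t * cos (h t) - x t * sin (h t)).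
  - intros t; symmetry; apply touching_point, Hh.
  - destruct (velocity_of_normal t0 theta Hn) as [Ex Ey].
    pose proof (C2p_curvature c T Hc t0) as K.
    destruct (touching_point t0 theta Hn) as [E _].
    derive_from_hyps.
    rewrite h0, Ex, Ey, E.
    generalize (sin2_cos2 theta); unfold Rsqr; intros S.
    transitivity (v t0 * (sin theta * sin theta + cos theta * cos theta)
      - curvature c t0 * v t0 * (x t0 * cos theta + y t0 * sin theta)); [ring|].
    rewrite S; field; lra.
Qed.

Lemma support_second_derivative (theta : R) :
  is_derive (Derive p) theta (Derive_n p 2 theta).
Proof.
  destruct (gamma_point theta) as (s & Hn & _).
  apply (Derive_correct (Derive p)); eexists; apply (second_derivative_at s theta Hn).
Qed.

Let second_derivative_value (t theta : R) :
  normal_at t theta -> Derive_n p 2 theta = / curvature c t - p theta.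
Proof. intros Hn; exact (is_derive_unique _ _ _ (second_derivative_at t theta Hn)). Qed.

Lemma support_radius_of_curvature (theta : R) :
  rho theta = p theta + Derive_n p 2 theta.
Proof.
  destruct (gamma_point theta) as (s & Hn & Er & _).
  rewrite Er, (second_derivative_value s theta Hn); ring.
Qed.

(** Along the lift [p''] equals the reciprocal of the curvature minus [p], which is continuous in
    [t]; monotonicity of [h] carries this over to the angle. *)
Lemma support_second_derivative_continuous (theta : R) : continuous (Derive_n p 2) theta.
Proof.
  destruct (gamma_point theta) as (t0 & Hn & _).
  destruct (normal_lift t0 theta Hn) as (h & h0 & h_der & Hh).
  rewrite <- h0.
  assert (h_cont : forall t, continuous h t) by (intros; exact (is_derive_continuous h _ _ h_der)).
  apply (continuous_reparam h _ t0 h_cont).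
  { apply (is_derive_increasing h _ h_der lift_speed_pos). }
  apply continuous_ext with
    (fun t => v t ^ 3 * / (x' t * y'' t - y' t * x'' t) - p (h t)).
  - intros t; rewrite (second_derivative_value t (h t) (Hh t)); f_equal.
    unfold curvature; fold x y; fold x' y' x'' y''; fold v.
    field; split; [generalize (v_pos t)|generalize (curvature_numerator_pos t)]; lra.
  - apply (continuous_minus (fun t => v t ^ 3 * / (x' t * y'' t - y' t * x'' t))
             (fun t => p (h t))).
    + apply (continuous_mult (fun t => v t ^ 3) (fun t => / (x' t * y'' t - y' t * x'' t))).
      * assert (v_cont : continuous v t0).
        { apply (continuous_comp (fun t => x' t ^ 2 + y' t ^ 2) sqrt); [cont|].
          apply continuous_sqrt. }
        apply continuous_ext with (fun t => v t * v t ^ 2);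
          [intros t; change (v t * v t ^ 2 = v t ^ 3 :> R); ring|cont].
      * apply (continuous_comp (fun t => x' t * y'' t - y' t * x'' t) Rinv); [cont|].
        apply continuity_pt_filterlim, continuity_pt_inv; [apply continuity_pt_id|].
        generalize (curvature_numerator_pos t0); lra.
    + apply (continuous_comp h p); cont.
Qed.

(** The touching point lies on the circle, so the Cauchy-Schwarz inequality bounds [p] above; the
    point of the circle in direction [theta] lies on [c] and bounds it below. *)
Lemma circle_support (a b r : R) :
  0 < r ->
  (forall q : R * R, (exists t, c t = q) <-> (fst q - a) ^ 2 + (snd q - b) ^ 2 = r ^ 2) ->
  forall theta, p theta = r + a * cos theta + b * sin theta.
Proof.
  intros Hr Hcirc theta.
  generalize (sin2_cos2 theta); unfold Rsqr; intros S.
  apply Rle_antisym.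
  - destruct (support_touched theta) as [s ->].
    pose proof (proj1 (Hcirc (c s)) (ex_intro _ s eq_refl)) as E.
    change ((xcoord c s - a) ^ 2 + (ycoord c s - b) ^ 2 = r ^ 2) in E.
    set (X := xcoord c s - a) in *; set (Y := ycoord c s - b) in *.
    replace (xcoord c s) with (X + a) by (unfold X; ring).
    replace (ycoord c s) with (Y + b) by (unfold Y; ring).
    assert (L : (X * cos theta + Y * sin theta) ^ 2 <= r ^ 2).
    { replace (r ^ 2) with
        ((X ^ 2 + Y ^ 2) * (sin theta * sin theta + cos theta * cos theta)) by (rewrite S, E; ring).
      generalize (pow2_ge_0 (X * sin theta - Y * cos theta)); nra. }
    assert (X * cos theta + Y * sin theta <= r) by nra.
    lra.
  - destruct (proj2 (Hcirc (a + r * cos theta, b + r * sin theta))) as [t Et].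
    { simpl; transitivity (r * r * (sin theta * sin theta + cos theta * cos theta));
        [|rewrite S]; ring. }
    pose proof (support_upper_bound t theta) as B.
    unfold xcoord, ycoord in B; rewrite Et in B; simpl in B.
    replace r with (r * (sin theta * sin theta + cos theta * cos theta)) at 1 by (rewrite S; ring).
    lra.
Qed.

End SupportFunction.

(** * Decomposition of the inequality and its equality cases *)

Theorem theorem1p2
  (c : R -> R * R) (T : R) (gamma : R -> R * R) (rho p : R -> R)
  (Hc : C2_plus_closed_convex c T)
  (Hgamma : normal_angle_param c gamma rho)
  (Hp : is_support_function gamma p)
  (alpha beta lambda delta : R)
  (H1 : 0 <= 2 * alpha + delta)
  (H2 : 0 <= 2 * alpha + 4 * PI * beta + lambda)
  (H3 : 0 <= 6 * alpha - lambda + 4 * delta) :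
  let E := alpha * RInt (fun theta => rho theta ^ 2) 0 (2 * PI)
           + beta * curve_length p ^ 2
           + lambda * enclosed_area p
           + delta * Rabs (curvature_centers_area p) in
  0 <= E /\
  (is_circle c -> 2 * alpha + 4 * PI * beta + lambda = 0 -> E = 0) /\
  (E = 0 ->
   0 < 2 * alpha + delta ->
   2 * alpha + 4 * PI * beta + lambda = 0 ->
   6 * alpha - lambda + 4 * delta = 0 ->
   exists a0 a1 b1 a2 b2 : R, forall theta,
     p theta = a0 + a1 * cos theta + b1 * sin theta
               + a2 * cos (2 * theta) + b2 * sin (2 * theta)).
Proof.
  intros E.
  pose proof PI_RGT_0 as HPI.
  set (p' := Derive p).
  set (p'' := Derive_n p 2).
  assert (p_der : forall x, is_derive p x (p' x)) by exact (support_derivative gamma p Hp).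
  assert (p'_der : forall x, is_derive p' x (p'' x))
    by exact (support_second_derivative c T gamma rho p Hc Hgamma Hp).
  assert (p''_cont : forall x, continuous p'' x)
    by exact (support_second_derivative_continuous c T gamma rho p Hc Hgamma Hp).
  assert (p_per : forall x, p (x + 2 * PI) = p x) by exact (supp_periodic gamma p Hp).
  assert (p'_per := derive_periodic p p' _ p_per p_der).
  assert (p_ends : p 0 = p (2 * PI)) by (rewrite <- (p_per 0), Rplus_0_l; reflexivity).
  assert (p'_ends : p' 0 = p' (2 * PI)) by (rewrite <- (p'_per 0), Rplus_0_l; reflexivity).
  assert (p_cont : forall x, continuous p x) by (intros; cont).
  assert (p'_cont : forall x, continuous p' x) by (intros; cont).
  set (X := RInt (fun x => p x ^ 2) 0 (2 * PI) : R).
  set (Y := RInt (fun x => p' x ^ 2) 0 (2 * PI) : R).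
  set (Z := RInt (fun x => p'' x ^ 2) 0 (2 * PI) : R).
  set (L := RInt p 0 (2 * PI) : R).
  set (m := L / (2 * PI)).
  assert (pp'' : RInt (fun x => p x * p'' x) 0 (2 * PI) = - Y :> R)
    by (apply (RInt_by_parts_periodic p p' p''); assumption).
  assert (E_rho : RInt (fun theta => rho theta ^ 2) 0 (2 * PI) = X - 2 * Y + Z :> R).
  { rewrite (RInt_lin3_eq (fun theta => rho theta ^ 2) (fun x => p x ^ 2)
               (fun x => p x * p'' x) (fun x => p'' x ^ 2) 1 2 1); [|intros th|intros; cont ..].
    - rewrite pp''; unfold X, Y, Z; ring.
    - rewrite (support_radius_of_curvature c T gamma rho p Hc Hgamma Hp); fold p''; ring. }
  assert (E_area : enclosed_area p = (X - Y) / 2).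
  { unfold enclosed_area.
    rewrite (RInt_lin3_eq (fun theta => p theta ^ 2 - Derive p theta ^ 2) (fun x => p x ^ 2)
               (fun x => p' x ^ 2) (fun _ => 0) 1 (-1) 0); [|intros|intros; cont ..].
    - unfold X, Y; rewrite RInt_const_R; field.
    - unfold p'; ring. }
  assert (E_centers : curvature_centers_area p = (Y - Z) / 2).
  { unfold curvature_centers_area.
    rewrite (RInt_lin3_eq (fun theta => Derive p theta ^ 2 - Derive_n p 2 theta ^ 2)
               (fun x => p' x ^ 2) (fun x => p'' x ^ 2) (fun _ => 0) 1 (-1) 0);
      [|intros|intros; cont ..].
    - unfold Y, Z; rewrite RInt_const_R; field.
    - unfold p', p''; ring. }
  (* The derivative [p'] has mean zero by periodicity. The resulting bound makes the oriented area
     of the curvature centers nonpositive, which settles its absolute value. *)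
  assert (HYZ : Y <= Z).
  { apply (wirtinger_full_period p' p'' p'_der p''_cont p'_ends).
    rewrite (RInt_primitive p p' 0 (2 * PI) p_der p'_cont); lra. }
  assert (E_mean : RInt (fun x => (p x - m) ^ 2) 0 (2 * PI) = X - L ^ 2 / (2 * PI) :> R).
  { rewrite (RInt_lin3_eq (fun x => (p x - m) ^ 2) (fun x => p x ^ 2) p (fun _ => 1)
               1 (- 2 * m) (m ^ 2)); [|intros; ring|intros; cont ..].
    rewrite RInt_const_R; fold X L; unfold m; field; lra. }
  (* This is the isoperimetric inequality, obtained from Wirtinger's inequality for [p - m]. *)
  assert (HXY : X - L ^ 2 / (2 * PI) <= Y).
  { rewrite <- E_mean.
    apply (wirtinger_full_period (fun x => p x - m) p').
    - intros x; derive_from_hyps; ring.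
    - assumption.
    - rewrite p_ends; reflexivity.
    - rewrite (RInt_lin3_eq (fun x => p x - m) p (fun _ => 1) (fun _ => 0) 1 (- m) 0);
        [|intros; ring|intros; cont ..].
      rewrite !RInt_const_R; fold L; unfold m; field; lra. }
  set (Q := Z - 5 * Y + 4 * (X - L ^ 2 / (2 * PI))).
  assert (E_Q : RInt (fun x => p'' x ^ 2 - 5 * p' x ^ 2 + 4 * (p x - m) ^ 2) 0 (2 * PI) = Q :> R).
  { rewrite (RInt_lin3_eq (fun x => p'' x ^ 2 - 5 * p' x ^ 2 + 4 * (p x - m) ^ 2)
               (fun x => p'' x ^ 2) (fun x => p' x ^ 2) (fun x => (p x - m) ^ 2) 1 (-5) 4);
      [|intros; ring|intros; cont ..].
    rewrite E_mean; unfold Q, X, Y, Z; ring. }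
  assert (HQ : 0 <= Q).
  { rewrite <- E_Q; apply (fourth_order_nonneg p p' p''); assumption. }
  assert (E_split : E = (2 * alpha + 4 * PI * beta + lambda) * (L ^ 2 / (4 * PI))
    + (6 * alpha - lambda + 4 * delta) * ((Y - (X - L ^ 2 / (2 * PI))) / 2)
    + (2 * alpha + delta) * (Q / 2)).
  { unfold E, curve_length; rewrite E_rho, E_area, E_centers, Rabs_left1 by lra.
    fold L; unfold Q; field; lra. }
  split; [|split].
  - rewrite E_split.
    assert (0 <= L ^ 2 / (4 * PI)).
    { apply Rmult_le_pos; [apply pow2_ge_0|left; apply Rinv_0_lt_compat; lra]. }
    repeat apply Rplus_le_le_0_compat; apply Rmult_le_pos; lra.
  - intros (a & b & r & Hr & Hcirc) H0.
    pose proof (circle_support c T gamma rho p Hc Hgamma Hp a b r Hr Hcirc) as Ep.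
    assert (Ep' : forall x, p' x = b * cos x - a * sin x).
    { intros x; apply is_derive_unique.
      apply is_derive_ext with (fun x => r + a * cos x + b * sin x);
        [intros; symmetry; apply Ep|].
      auto_derive; [exact I|ring]. }
    assert (Ep'' : forall x, p'' x = r - p x).
    { intros x; rewrite Ep; rewrite <- (is_derive_unique _ _ _ (p'_der x)).
      apply is_derive_unique.
      apply is_derive_ext with (fun x => b * cos x - a * sin x);
        [intros; symmetry; apply Ep'|].
      auto_derive; [exact I|ring]. }
    (* Since [p'' = r - p], the function [r * x - p'] is a primitive of [p]. *)
    assert (EL : L = 2 * PI * r).
    { unfold L; rewrite (RInt_primitive (fun x => r * x - p' x) p).
      - rewrite p'_ends; ring.
      - intros x; derive_from_hyps; rewrite Ep''; ring.
      - assumption. }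
    assert (Em : m = r) by (unfold m; rewrite EL; field; lra).
    assert (EZ : Z = X - L ^ 2 / (2 * PI)).
    { rewrite <- E_mean, Em; apply RInt_ext; intros x _.
      change (p'' x ^ 2 = (p x - r) ^ 2 :> R); rewrite Ep''; ring. }
    (* With [X - L ^ 2 / (2 * PI) = Y = Z] both the isoperimetric gap and [Q] vanish, leaving only
       the term whose coefficient is zero. *)
    assert (EY : Y = Z).
    { assert (Hpp : RInt (fun x => p x * p'' x) 0 (2 * PI) = r * L - X :> R).
      { rewrite (RInt_lin3_eq (fun x => p x * p'' x) p (fun x => p x ^ 2) (fun _ => 0) r (-1) 0);
          [|intros; rewrite Ep''; ring|intros; cont ..].
        rewrite RInt_const_R; fold L X; ring. }
      assert (L ^ 2 / (2 * PI) = r * L) by (rewrite EL; field; lra).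
      lra. }
    rewrite E_split, H0, <- EZ, EY; unfold Q; rewrite <- EZ, EY; field; lra.
  - intros E0 Hpos H2' H3'.
    apply (fourth_order_equality p p' p''); try assumption.
    fold L; fold m; rewrite E_Q.
    rewrite E_split, H2', H3' in E0.
    (* Two of the three coefficients are zero and the third is positive, so equality forces
       [Q = 0]. *)
    assert (Z0 : (2 * alpha + delta) * (Q / 2) = 0) by lra.
    apply Rmult_integral in Z0; lra.
Qed.
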